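(* Let $a,b\in\mathbb{C}$ with $a\ne b$, let $m\ge n\ge 1$ be integers, and let $f(z)=(z-a)^m(z-b)^n$. Let $S_f$ be the rational map $$S_f(z)=z-\frac{f(z)f'(z)}{f'(z)^2-f(z)f''(z)}$$ (Schröder's method applied to $f$), and let $J_{m,n,a,b}$ denote its Julia set. Then: (1) If $m=n$, then $J_{m,m,a,b}$ is the line of points equidistant from $a$ and $b$. (2) If $m>n\ge 1$, then $J_{m,n,a,b}$ is the circle $$J_{m,n,a,b}=\left\{z\in\mathbb{C}: \left|z-\frac{b m^2-a n^2}{m^2-n^2}\right|=\frac{mn |a-b|}{m^2-n^2}\right\}.$$
   Context: $S_f$ is regarded as a rational map of the Riemann sphere (after cancelling common factors). The Julia set of a rational map is the standard one from complex dynamics (the complement of the set of points where the family of iterates is normal). *)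

(* Defs.v *)
From mathcomp Require Import all_boot all_order all_algebra.
From mathcomp Require Import reals.
From mathcomp.real_closed Require Import complex.
Set Implicit Arguments. Unset Strict Implicit. Unset Printing Implicit Defensive.
Import Order.TTheory GRing.Theory Num.Theory.
Local Open Scope ring_scope.

Section Sphere.
Variable R : realType.
Local Notation C := R[i].

(* The Riemann sphere: [Some z] is the finite point z, [None] is infinity. *)
Definition sphere := option C.

Definition cmod (z : C) : R := Num.sqrt (complex.Re z ^+ 2 + complex.Im z ^+ 2).

Definition chordal (x y : sphere) : R :=
  match x, y with
  | Some z, Some w =>
      2 * cmod (z - w) / (Num.sqrt (1 + cmod z ^+ 2) * Num.sqrt (1 + cmod w ^+ 2))
  | Some z, None | None, Some z => 2 / Num.sqrt (1 + cmod z ^+ 2)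
  | None, None => 0
  end.

Definition ratmap (P Q : {poly C}) (x : sphere) : sphere :=
  let P' := P %/ gcdp P Q in
  let Q' := Q %/ gcdp P Q in
  match x with
  | Some z => if Q'.[z] == 0 then None else Some (P'.[z] / Q'.[z])
  | None =>
      if (size Q' < size P')%N then None
      else if (size P' < size Q')%N then Some 0
      else Some (lead_coef P' / lead_coef Q')
  end.

(* The family F (indexed by nat) is normal on U: every sequence of members of
   the family has a subsequence converging locally uniformly on U (w.r.t. the
   chordal metric, limits in the sphere, so convergence to infinity is allowed). *)
Definition normal_on (F : nat -> sphere -> sphere) (U : sphere -> Prop) : Prop :=
  forall s : nat -> nat,
  exists phi : nat -> nat, (forall j, (phi j < phi j.+1)%N) /\
  exists g : sphere -> sphere,
  forall w, U w ->
  exists rho : R, 0 < rho /\ (forall x, chordal w x < rho -> U x) /\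
    forall eps : R, 0 < eps -> exists N : nat, forall j, (N <= j)%N ->
      forall x, chordal w x < rho -> chordal (F (s (phi j)) x) (g x) < eps.

Definition fatou (S : sphere -> sphere) (x : sphere) : Prop :=
  exists r : R, 0 < r /\ normal_on (fun k => iter k S) (fun y => chordal x y < r).

Definition julia (S : sphere -> sphere) (x : sphere) : Prop := ~ fatou S x.

Definition fpoly (m n : nat) (a b : C) : {poly C} :=
  ('X - a%:P) ^+ m * ('X - b%:P) ^+ n.

Definition schroeder_den (f : {poly C}) : {poly C} :=
  f^`() ^+ 2 - f * f^`(2).
Definition schroeder_num (f : {poly C}) : {poly C} :=
  'X * schroeder_den f - f * f^`().
Definition schroeder (f : {poly C}) : sphere -> sphere :=
  ratmap (schroeder_num f) (schroeder_den f).

End Sphere.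

(* Main.v *)
(* In the coordinate [T z = - n (z - a) / (m (z - b))] the map [S_f] becomes
   [t |-> t^2], whose Julia set is the unit circle, so that the Julia set of [S_f]
   is the circle of Apollonius [n |z - a| = m |z - b|]. The conjugacy preserves
   normality because Möbius maps are bi-Lipschitz for the chordal metric; this is
   seen in homogeneous coordinates, where the chordal distance is
   [2 |v ∧ w| / (|v| |w|)] and a Möbius map is linear, multiplying [v ∧ w] by its
   determinant. *)
Require Import Defs.
From mathcomp Require Import all_boot all_order all_algebra.
From mathcomp Require Import boolp reals ring lra.
From mathcomp.real_closed Require Import complex.
Import Order.TTheory GRing.Theory Num.Theory.
Local Open Scope ring_scope.
Local Open Scope complex_scope.

(** * The chordal metric in homogeneous coordinates *)

Section ChordalMetric.
Context {R : realType}.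
Local Notation C := R[i].
Implicit Types (x y z w : sphere R) (p q : C).

Lemma norm_cmod p : `|p| = (cmod p)%:C. Proof. exact: normc_def. Qed.

Lemma cmodM p q : cmod (p * q) = cmod p * cmod q.
Proof. by apply: complexI; rewrite rmorphM /= -!norm_cmod normrM. Qed.

Lemma cmodD p q : cmod (p + q) <= cmod p + cmod q.
Proof. by rewrite -lecR rmorphD /= -!norm_cmod ler_normD. Qed.

Lemma cmodN p : cmod (- p) = cmod p.
Proof. by apply: complexI; rewrite /= -!norm_cmod normrN. Qed.

Lemma cmod_eq0 p : (cmod p == 0) = (p == 0).
Proof. by rewrite -(inj_eq (@complexI R)) -norm_cmod normr_eq0. Qed.

Lemma cmod_ge0 p : 0 <= cmod p. Proof. exact: sqrtr_ge0. Qed.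

Lemma cmod_gt0 p : (0 < cmod p) = (p != 0).
Proof. by rewrite lt0r cmod_eq0 cmod_ge0 andbT. Qed.

Lemma cmod0 : cmod (0 : C) = 0. Proof. by apply/eqP; rewrite cmod_eq0. Qed.

Lemma cmod_real (r : R) : cmod r%:C = `|r|.
Proof. by rewrite /cmod /= expr0n addr0 sqrtr_sqr. Qed.

Lemma cmod1 : cmod (1 : C) = 1. Proof. by rewrite (cmod_real 1) normr1. Qed.

Lemma cmodV p : cmod p^-1 = (cmod p)^-1.
Proof. by apply: complexI; rewrite fmorphV /= -!norm_cmod normfV. Qed.

Lemma cmodX p k : cmod (p ^+ k) = cmod p ^+ k.
Proof. by apply: complexI; rewrite rmorphXn /= -!norm_cmod normrX. Qed.

Lemma cmodB p q : cmod (p - q) = cmod (q - p).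
Proof. by rewrite -cmodN opprB. Qed.

Definition pnorm (v : C * C) : R := Num.sqrt (cmod v.1 ^+ 2 + cmod v.2 ^+ 2).

Definition wedge (v w : C * C) : C := v.1 * w.2 - v.2 * w.1.

Definition hom x : C * C := if x is Some p then (p, 1) else (1, 0).

(* The point [p : q] of the projective line; the junk value [ratio 0 0] is [None]. *)
Definition ratio p q : sphere R := if q == 0 then None else Some (p / q).

(** Reading the two moduli as real and imaginary part of one complex number lets [pnormD] inherit
    the triangle inequality of [cmod]. *)
Lemma pnormE v : pnorm v = cmod (cmod v.1 +i* cmod v.2). Proof. by []. Qed.

Lemma pnormD (v w : C * C) : pnorm (v.1 + w.1, v.2 + w.2) <= pnorm v + pnorm w.
Proof.
rewrite !pnormE /=; apply: le_trans (cmodD _ _).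
rewrite /cmod /= -!/(cmod _) ler_wsqrtr // lerD // ler_pXn2r ?nnegrE ?addr_ge0 ?cmod_ge0 //;
  exact: cmodD.
Qed.

Lemma pnormZ p (v : C * C) : pnorm (p * v.1, p * v.2) = cmod p * pnorm v.
Proof.
rewrite /pnorm /= !cmodM !exprMn -mulrDr sqrtrM ?sqr_ge0 // sqrtr_sqr.
by rewrite ger0_norm ?cmod_ge0.
Qed.

Lemma pnorm_ge0 v : 0 <= pnorm v. Proof. exact: sqrtr_ge0. Qed.

Lemma pnorm_gt0 v : v != (0, 0) -> 0 < pnorm v.
Proof.
case: v => p q; rewrite xpair_eqE negb_and => pq; rewrite sqrtr_gt0 /=.
case/orP: pq; rewrite -cmod_gt0 => h; [apply: ltr_pwDl|apply: ltr_wpDl];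
  by rewrite ?exprn_gt0 ?sqr_ge0.
Qed.

Lemma cmod1_le_pnorm v : cmod v.1 <= pnorm v.
Proof.
rewrite -[leLHS]ger0_norm ?cmod_ge0 // -sqrtr_sqr ler_wsqrtr //.
by rewrite lerDl sqr_ge0.
Qed.

Lemma cmod2_le_pnorm v : cmod v.2 <= pnorm v.
Proof.
rewrite -[leLHS]ger0_norm ?cmod_ge0 // -sqrtr_sqr ler_wsqrtr //.
by rewrite lerDr sqr_ge0.
Qed.

Lemma hom_neq0 x : hom x != (0, 0).
Proof. by case: x => [p|]; rewrite xpair_eqE oner_eq0 ?andbF. Qed.

Lemma pnorm_hom_gt0 x : 0 < pnorm (hom x).
Proof. exact/pnorm_gt0/hom_neq0. Qed.

Lemma chordalE x y :
  chordal x y = 2 * cmod (wedge (hom x) (hom y)) / (pnorm (hom x) * pnorm (hom y)).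
Proof.
rewrite /wedge /pnorm; case: x y => [p|] [q|] /=;
rewrite ?cmod0 ?cmod1 ?mul1r ?mulr1 ?mul0r ?mulr0 ?subr0 ?sub0r ?subrr;
rewrite ?cmodN ?cmod0 ?cmod1 ?expr1n ?expr0n /= ?addr0 ?sqrtr1 ?mulr1 ?mul1r ?mulr0 ?mul0r //;
by rewrite ![1 + _]addrC.
Qed.

Lemma chordalC x y : chordal x y = chordal y x.
Proof.
rewrite !chordalE [X in _ / X]mulrC; congr (_ * _ / _).
by rewrite -cmodN /wedge opprB ![(hom y).1 * _]mulrC ![(hom y).2 * _]mulrC.
Qed.

Lemma chordalxx x : chordal x x = 0.
Proof. by rewrite chordalE /wedge [X in X - _]mulrC subrr cmod0 mulr0 mul0r. Qed.

(* Plücker's relation [(x ∧ z) y = (x ∧ y) z + (y ∧ z) x] in [C^2] reduces this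
   to the triangle inequality for the Hermitian norm. *)
Lemma chordal_triangle x y z : chordal x z <= chordal x y + chordal y z.
Proof.
rewrite !chordalE.
have := pnorm_hom_gt0 x; have := pnorm_hom_gt0 y; have := pnorm_hom_gt0 z.
set u := hom x; set v := hom y; set w := hom z => w0 v0 u0.
have key : cmod (wedge u w) * pnorm v <=
    cmod (wedge u v) * pnorm w + cmod (wedge v w) * pnorm u.
  rewrite -!pnormZ; apply: le_trans (pnormD _ _) => /=; rewrite le_eqVlt.
  by apply/orP; left; apply/eqP; congr (pnorm (_, _)); rewrite /wedge; ring.
have -> : 2 * cmod (wedge u v) / (pnorm u * pnorm v) +
          2 * cmod (wedge v w) / (pnorm v * pnorm w) =
   2 * (cmod (wedge u v) * pnorm w + cmod (wedge v w) * pnorm u) /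
   (pnorm u * pnorm v * pnorm w) by field; rewrite !gt_eqF.
rewrite ler_pdivrMr ?mulr_gt0 //.
rewrite [leRHS](_ : _ =
  2 * (cmod (wedge u v) * pnorm w + cmod (wedge v w) * pnorm u) / pnorm v); last first.
  by field; rewrite !gt_eqF.
by rewrite ler_pdivlMr // -mulrA ler_pM2l.
Qed.

Lemma ratioZ (c p q : C) : c != 0 -> ratio (c * p) (c * q) = ratio p q.
Proof.
move=> c0; rewrite /ratio mulf_eq0 (negbTE c0) /=; case: (q =P 0) => // /eqP q0.
by congr Some; field; rewrite q0 c0.
Qed.

Lemma hom_ratio p q : (p, q) != (0, 0) ->
  exists2 c : C, c != 0 & hom (ratio p q) = (c * p, c * q).
Proof.
rewrite xpair_eqE negb_and /ratio; case: (q =P 0) => [->|/eqP q0 _].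
  rewrite orbF => p0; exists p^-1; rewrite ?invr_eq0 //.
  by rewrite mulVf // mulr0.
by exists q^-1; rewrite ?invr_eq0 // mulVf // mulrC.
Qed.

Lemma ratio_hom x : ratio (hom x).1 (hom x).2 = x.
Proof. by case: x => [p|]; rewrite /ratio ?eqxx ?oner_eq0 //= divr1. Qed.

Lemma ratioP x : exists p q, (p, q) != (0, 0) /\ x = ratio p q.
Proof. by exists (hom x).1, (hom x).2; rewrite ratio_hom -surjective_pairing hom_neq0. Qed.

Lemma chordal_ratio (v w : C * C) : v != (0, 0) -> w != (0, 0) ->
  chordal (ratio v.1 v.2) (ratio w.1 w.2) = 2 * cmod (wedge v w) / (pnorm v * pnorm w).
Proof.
move=> v0 w0; rewrite chordalE.
have [|c c0 ->] := @hom_ratio v.1 v.2; first by rewrite -surjective_pairing.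
have [|d d0 ->] := @hom_ratio w.1 w.2; first by rewrite -surjective_pairing.
have -> : wedge (c * v.1, c * v.2) (d * w.1, d * w.2) = c * d * wedge v w.
  by rewrite /wedge /=; ring.
rewrite !pnormZ !cmodM; field.
by rewrite !gt_eqF ?pnorm_gt0 ?cmod_gt0.
Qed.

(** * Möbius maps, acting linearly on homogeneous coordinates *)

Definition mobius (p q r s : C) x : sphere R :=
  ratio (p * (hom x).1 + q * (hom x).2) (r * (hom x).1 + s * (hom x).2).

(** Applying the adjugate matrix to the image gives the determinant times the vector, so a zero
    image forces a zero vector. *)
Lemma mobius_neq0 (p q r s : C) (v : C * C) : p * s - q * r != 0 -> v != (0, 0) ->
  (p * v.1 + q * v.2, r * v.1 + s * v.2) != (0, 0).
Proof.
case: v => x y /= d0; rewrite !xpair_eqE => xy; apply: contra xy => /andP[/eqP h1 /eqP h2].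
have e1 : (p * s - q * r) * x = 0.
  transitivity (s * (p * x + q * y) - q * (r * x + s * y)); first by ring.
  by rewrite h1 h2 !mulr0 subrr.
have e2 : (p * s - q * r) * y = 0.
  transitivity (p * (r * x + s * y) - r * (p * x + q * y)); first by ring.
  by rewrite h1 h2 !mulr0 subrr.
by move/eqP: e1; move/eqP: e2; rewrite !mulf_eq0 (negbTE d0) /= => -> ->.
Qed.

Lemma mobius_ratio (p q r s x y : C) : (x, y) != (0, 0) ->
  mobius p q r s (ratio x y) = ratio (p * x + q * y) (r * x + s * y).
Proof.
move=> /hom_ratio[c c0 h]; rewrite /mobius h /= -[RHS](ratioZ c) //.
by congr ratio; ring.
Qed.

(** The adjugate serves as inverse: the composite scales homogeneous coordinates by the determinant,
    which [ratioZ] removes. *)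
Lemma mobiusK (p q r s : C) : p * s - q * r != 0 ->
  cancel (mobius p q r s) (mobius s (- q) (- r) p).
Proof.
move=> d0 x; rewrite {2}/mobius mobius_ratio; last exact: mobius_neq0 d0 (hom_neq0 x).
rewrite -[RHS]ratio_hom -[RHS](ratioZ (p * s - q * r)) //.
by congr ratio; ring.
Qed.

Lemma mobiusVK (p q r s : C) : p * s - q * r != 0 ->
  cancel (mobius s (- q) (- r) p) (mobius p q r s).
Proof.
move=> d0; rewrite -{2}[q]opprK -{2}[r]opprK; apply: mobiusK.
by rewrite mulrNN mulrC.
Qed.

Lemma pnorm_mobius (p q r s : C) (v : C * C) :
  pnorm (p * v.1 + q * v.2, r * v.1 + s * v.2)
    <= (cmod p + cmod q + cmod r + cmod s) * pnorm v.
Proof.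
have h1 : pnorm (p * v.1 + q * v.2, r * v.1 + s * v.2) <=
  cmod (p * v.1 + q * v.2) + cmod (r * v.1 + s * v.2).
  rewrite -[leRHS]ger0_norm ?addr_ge0 ?cmod_ge0 // -sqrtr_sqr ler_wsqrtr //= sqrrD.
  by rewrite lerD2r lerDl mulrn_wge0 // mulr_ge0 ?cmod_ge0.
apply: le_trans h1 _; apply: le_trans (lerD (cmodD _ _) (cmodD _ _)) _.
by rewrite !cmodM !mulrDl !addrA !lerD // ler_wpM2l ?cmod_ge0 ?cmod1_le_pnorm ?cmod2_le_pnorm.
Qed.

(** The wedge in the numerator is multiplied by [D], and each norm in the denominator becomes at
    least [cmod D / k] times the old one, by [pnorm_mobius] for the adjugate. Hence the constant
    [k ^+ 2 / cmod D]. *)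
Lemma mobius_lipschitz (p q r s : C) : p * s - q * r != 0 ->
  exists2 K : R, 0 < K &
    forall x y, chordal (mobius p q r s x) (mobius p q r s y) <= K * chordal x y.
Proof.
move=> d0; set D := p * s - q * r.
set k := cmod s + cmod (- q) + cmod (- r) + cmod p.
have low v : cmod D * pnorm v <= k * pnorm (p * v.1 + q * v.2, r * v.1 + s * v.2).
  apply: le_trans (pnorm_mobius s (- q) (- r) p _); rewrite -pnormZ le_eqVlt /=.
  by apply/orP; left; apply/eqP; congr (pnorm (_, _)); rewrite /D; ring.
have D0 : 0 < cmod D by rewrite cmod_gt0.
have k0 : 0 < k.
  have := low (1, 0); have /= h := @pnorm_gt0 (1, 0) (hom_neq0 None).
  have : 0 < cmod D * pnorm (1, 0) by rewrite mulr_gt0.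
  move=> /lt_le_trans h' /h'; rewrite pmulr_lgt0 //.
  exact/pnorm_gt0/(mobius_neq0 p q r s (1, 0))/(hom_neq0 None).
exists (k ^+ 2 / cmod D) => [|x y]; first by rewrite divr_gt0 ?exprn_gt0.
rewrite /mobius.
rewrite (chordal_ratio (p * (hom x).1 + q * (hom x).2, r * (hom x).1 + s * (hom x).2)
  (p * (hom y).1 + q * (hom y).2, r * (hom y).1 + s * (hom y).2)) ?mobius_neq0 ?hom_neq0 //.
rewrite chordalE; have := low (hom x); have := low (hom y).
have := pnorm_hom_gt0 x; have := pnorm_hom_gt0 y.
have := pnorm_gt0 _ (mobius_neq0 p q r s _ d0 (hom_neq0 x)).
have := pnorm_gt0 _ (mobius_neq0 p q r s _ d0 (hom_neq0 y)).
set u := hom x; set v := hom y.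
set u' := (p * u.1 + q * u.2, _); set v' := (p * v.1 + q * v.2, _).
move=> v'0 u'0 v0 u0 lv lu.
have -> : wedge u' v' = D * wedge u v by rewrite /wedge /D /=; ring.
rewrite cmodM ler_pdivrMr ?mulr_gt0 //.
rewrite [leRHS](_ : _ = 2 * cmod (wedge u v) * ((k * pnorm u') * (k * pnorm v'))
   / (cmod D * pnorm u * pnorm v)); last by field; rewrite !gt_eqF.
rewrite ler_pdivlMr ?mulr_gt0 //.
rewrite [leLHS](_ : _ = 2 * cmod (wedge u v) *
  ((cmod D * pnorm u) * (cmod D * pnorm v))); last by ring.
rewrite ler_wpM2l ?mulr_ge0 ?cmod_ge0 // ler_pM // mulr_ge0 ?cmod_ge0 ?pnorm_ge0 //.
Qed.

End ChordalMetric.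

(** * Extraction of subsequences *)

Section Subsequences.

Lemma exists_subsequence (P : nat -> nat -> Prop) :
  (forall j N, exists2 i, (N <= i)%N & P j i) ->
  exists phi : nat -> nat, (forall j, (phi j < phi j.+1)%N) /\ forall j, P j (phi j).
Proof.
move=> h.
have /choice[next nextP] : forall jN : nat * nat, exists i, (jN.2 <= i)%N /\ P jN.1 i.
  by move=> [j N]; have [k ? ?] := h j N; exists k.
pose phi := fix phi j := if j is i.+1 then next (i.+1, (phi i).+1) else next (0, 0)%N.
exists phi; split=> [j|[|j]]; first by case: (nextP (j.+1, (phi j).+1)).
- by case: (nextP (0, 0)%N).
- by case: (nextP (j.+1, (phi j).+1)).
Qed.

(** Normality is tested on arbitrary index sequences, not only increasing ones; this reduces them to
    two cases. If no value recurs infinitely often, each is eventually avoided, and induction on [k]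
    shows that [s] eventually stays at least [k]. *)
Lemma constant_or_divergent_subsequence (s : nat -> nat) :
  exists phi : nat -> nat, (forall j, (phi j < phi j.+1)%N) /\
    ((exists v, forall j, s (phi j) = v) \/ forall j, (j <= s (phi j))%N).
Proof.
case: (EM (exists v, forall N, exists2 i, (N <= i)%N & s i = v)) => [[v hv]|nv].
  have [phi [phi_inc phiP]] := @exists_subsequence (fun _ i => s i = v) (fun _ => hv).
  by exists phi; split=> //; left; exists v.
have large k : exists N, forall i, (N <= i)%N -> (k <= s i)%N.
  elim: k => [|k [N hN]]; first by exists 0%N.
  have [N' hN'] : exists N', forall i, (N' <= i)%N -> s i <> k.
    apply: contrapT => nk; apply: nv; exists k => N'.
    apply: contrapT => ni; apply: nk; exists N' => i N'i ik.
    by apply: ni; exists i.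
  exists (maxn N N') => i; rewrite geq_max => /andP[/hN ki /hN' /eqP].
  by rewrite ltn_neqAle eq_sym ki andbT.
have [|phi [phi_inc phiP]] := @exists_subsequence (fun j i => j <= s i)%N.
  move=> j N; have [N' hN'] := large j; exists (maxn N N'); first exact: leq_maxl.
  exact/hN'/leq_maxr.
by exists phi; split=> //; right.
Qed.

End Subsequences.

(** * Fatou sets: invariance under conjugacy *)

Section FatouSets.
Context {R : realType}.
Local Notation C := R[i].
Implicit Types (x y z w : sphere R) (p q : C).

Lemma chordal_ball_open x w (r : R) : chordal x w < r ->
  exists rho : R, 0 < rho /\ forall y, chordal w y < rho -> chordal x y < r.
Proof.
move=> xw; exists (r - chordal x w); split; first by rewrite subr_gt0.
by move=> y; rewrite ltrBrDl; apply: le_lt_trans; exact: chordal_triangle.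
Qed.

(** Since F^k = M S^k N, the limit [g] becomes M g N: the Lipschitz bound on [N] carries small balls
    around [w] into balls around [N w], and the one on [M] carries the uniform estimate back. *)
Lemma fatou_conj (S F M N : sphere R -> sphere R) (K L : R) x :
  (forall x, M (S x) = F (M x)) -> cancel M N -> cancel N M ->
  0 < K -> (forall x y, chordal (M x) (M y) <= K * chordal x y) ->
  0 < L -> (forall x y, chordal (N x) (N y) <= L * chordal x y) ->
  fatou S x -> fatou F (M x).
Proof.
move=> MS MK NK K0 Mlip L0 Nlip [r [r0 Snormal]].
have Nball u v e : chordal u v < e / L -> chordal (N u) (N v) < e.
  by rewrite ltr_pdivlMr // mulrC; apply: le_lt_trans.
exists (r / L); split=> [|s]; first by rewrite divr_gt0.
have [phi [phi_inc [g gP]]] := Snormal s.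
exists phi; split=> //; exists (fun y => M (g (N y))) => w xw.
have /gP[rho [rho0 [_ unif]]] : chordal x (N w) < r by rewrite -(MK x) Nball.
have [rho' [rho'0 sub]] := chordal_ball_open _ _ _ xw.
exists (Num.min rho' (rho / L)); split; first by rewrite lt_min rho'0 divr_gt0.
split=> [y|e e0]; first by rewrite lt_min => /andP[/sub].
have [|n nP] := unif (e / K); first by rewrite divr_gt0.
exists n => j nj y; rewrite lt_min => /andP[_ /Nball wy].
have -> : iter (s (phi j)) F y = M (iter (s (phi j)) S (N y)).
  by elim: (s _) => [|k /= ->]; rewrite ?NK // MS.
by apply: le_lt_trans (Mlip _ _) _; rewrite mulrC -ltr_pdivlMr // nP.
Qed.

(** * The Julia set of the squaring map *)

Definition sq x : sphere R := omap (fun p => p ^+ 2) x.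

Lemma sq_ratio p q : sq (ratio p q) = ratio (p ^+ 2) (q ^+ 2).
Proof. by rewrite /ratio sqrf_eq0; case: ifP => // _; rewrite /= expr_div_n. Qed.

Lemma iter_sq k p : iter k sq (Some p) = Some (p ^+ (2 ^ k)).
Proof.
by elim: k => [|k /= ->]; rewrite ?expr1 //= -exprM expnSr.
Qed.

Lemma chordal_le p q : chordal (Some p) (Some q) <= 2 * cmod (p - q).
Proof.
have h (t : C) : 1 <= Num.sqrt (1 + cmod t ^+ 2).
  by rewrite -[leLHS]sqrtr1 ler_wsqrtr // lerDl sqr_ge0.
rewrite /= ler_pdivrMr; last by rewrite mulr_gt0 // (lt_le_trans ltr01).
by rewrite ler_peMr ?mulr_ge0 ?cmod_ge0 // mulr_ege1.
Qed.

Lemma bernoulli_ge (h : R) k : 0 <= h -> 1 + h *+ k <= (1 + h) ^+ k.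
Proof.
move=> h0; elim: k => [|k IH]; first by rewrite mulr0n addr0.
rewrite exprS; apply: le_trans (_ : (1 + h) * (1 + h *+ k) <= _); last first.
  by rewrite ler_wpM2l // addr_ge0.
rewrite mulrSr -subr_ge0 (_ : _ - _ = h * (h *+ k)); first by rewrite mulr_ge0 // mulrn_wge0.
by ring.
Qed.

Lemma bernoulli_le (h : R) k : 0 <= h <= 1 -> 1 - h *+ k <= (1 - h) ^+ k.
Proof.
move=> /andP[h0 h1]; elim: k => [|k IH]; first by rewrite mulr0n subr0.
rewrite exprS; apply: le_trans (_ : (1 - h) * (1 - h *+ k) <= _); last first.
  by rewrite ler_wpM2l // subr_ge0.
rewrite mulrSr -subr_ge0 (_ : _ - _ = h * (h *+ k)); first by rewrite mulr_ge0 // mulrn_wge0.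
by ring.
Qed.

Lemma expr_small (c e : R) : 0 <= c < 1 -> 0 < e ->
  exists N : nat, forall k, (N <= k)%N -> c ^+ k < e.
Proof.
move=> /andP[c0 c1] e0; have [->|cn0] := eqVneq c 0.
  by exists 1%N => -[|k] // _; rewrite expr0n.
have {cn0}c0 : 0 < c by rewrite lt_neqAle eq_sym cn0.
(* Bernoulli's inequality for 1/c = 1 + h pushes (1/c)^k above 1/e as soon as k h exceeds 1/e. *)
set h := c^-1 - 1; have h0 : 0 < h by rewrite subr_gt0 invf_gt1.
exists (Num.bound (e^-1 / h)) => k Nk.
have : e^-1 / h < k%:R.
  apply: lt_le_trans (_ : (Num.bound (e^-1 / h))%:R <= _); last by rewrite ler_nat.
  by apply: archi_boundP; rewrite divr_ge0 ?invr_ge0 ?ltW.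
rewrite ltr_pdivrMr // mulr_natl => ek.
have : e^-1 < c^-1 ^+ k.
  rewrite -[c^-1](subrKC 1); apply: lt_le_trans (bernoulli_ge h k (ltW h0)).
  by apply: lt_le_trans ek _; rewrite lerDr.
by rewrite exprVn ltf_pV2 // posrE exprn_gt0.
Qed.

(** For a finite point with |q| > c, the bounds sqrt(1 + |p|^2) <= 2 and sqrt(1 + |q|^2) <= 1 + |q|
    give a chordal distance of at least (|q| - |p|) / (1 + |q|), which increases with |q|. Infinity
    is at distance at least 1. *)
Lemma chordal_ball_in_disc p (c : R) y : cmod p < 1 -> cmod p < c ->
  chordal (Some p) y < (c - cmod p) / (1 + c) -> exists2 q, y = Some q & cmod q <= c.
Proof.
move=> p1 pc; have p0 := cmod_ge0 p; have c0 : 0 < c := le_lt_trans p0 pc.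
have P0 : 0 < Num.sqrt (1 + cmod p ^+ 2) by rewrite sqrtr_gt0 ltr_wpDr ?sqr_ge0.
have P2 : Num.sqrt (1 + cmod p ^+ 2) <= 2.
  rewrite -[leRHS]ger0_norm // -sqrtr_sqr ler_wsqrtr //; nra.
case: y => [q|] /=; last first.
  rewrite ltNge => /negP[]; apply: le_trans (_ : 1 <= _).
    rewrite ler_pdivrMr; lra.
  by rewrite ler_pdivlMr // mul1r.
have q0 := cmod_ge0 q.
have Q0 : 0 < Num.sqrt (1 + cmod q ^+ 2) by rewrite sqrtr_gt0 ltr_wpDr ?sqr_ge0.
have Q1 : Num.sqrt (1 + cmod q ^+ 2) <= 1 + cmod q.
  rewrite -[leRHS]ger0_norm ?addr_ge0 // -sqrtr_sqr ler_wsqrtr //; nra.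
move=> close; exists q => //; rewrite leNgt; apply: contraL close => cq; rewrite -leNgt.
apply: le_trans (_ : (cmod q - cmod p) / (1 + cmod q) <= _).
  rewrite ler_pdivrMr; last lra.
  rewrite mulrAC ler_pdivlMr; last lra.
  nra.
have tri : cmod q - cmod p <= cmod (p - q).
  by rewrite lerBlDr cmodB; apply: le_trans (cmodD _ _); rewrite subrK.
rewrite ler_pdivrMr; last lra.
rewrite mulrAC ler_pdivlMr; last by rewrite mulr_gt0.
apply: le_trans (_ : cmod (p - q) * (2 * (1 + cmod q)) <= _); last by lra.
rewrite ler_pM ?mulr_ge0 ?subr_ge0 //; try lra.
by rewrite ler_pM // ltW.
Qed.

(** A small ball around [p] lies in a disc of radius c < 1. There, iterates with indices tending to
    infinity converge uniformly to 0, and a constant sequence of iterates converges to its own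
    term. *)
Lemma fatou_sq_lt1 p : cmod p < 1 -> fatou sq (Some p).
Proof.
move=> p1; have p0 := cmod_ge0 p; set c := (cmod p + 1) / 2.
have [pc c1 c0] : [/\ cmod p < c, c < 1 & 0 <= c] by rewrite /c; split; lra.
exists ((c - cmod p) / (1 + c)); split=> [|s].
  by rewrite divr_gt0 //; lra.
have [phi [phi_inc [[v sv]|s_inf]]] := constant_or_divergent_subsequence s;
  exists phi; split=> //.
  exists (iter v sq) => w pw; have [rho [rho0 sub]] := chordal_ball_open _ _ _ pw.
  exists rho; split=> //; split=> // e e0; exists 0%N => j _ y _.
  by rewrite sv chordalxx.
exists (fun _ => Some 0) => w pw; have [rho [rho0 sub]] := chordal_ball_open _ _ _ pw.
exists rho; split=> //; split=> // e e0.
have [||N NP] := expr_small c (e / 2) _ _; rewrite ?c0 ?divr_gt0 //.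
exists N => j Nj y /sub /chordal_ball_in_disc[//|//|q -> qc].
rewrite iter_sq; apply: le_lt_trans (chordal_le _ _) _.
rewrite subr0 cmodX mulrC -ltr_pdivlMr //.
apply: le_lt_trans (_ : c ^+ (2 ^ s (phi j)) < _).
  by rewrite ler_pXn2r ?expn_gt0 ?nnegrE ?cmod_ge0.
by apply: NP; rewrite (leq_trans Nj) // (leq_trans (s_inf j)) // ltnW // ltn_expl.
Qed.

(* Nearby points [c p] with [c < 1] are attracted to [0], whereas the orbit of
   [p] keeps chordal distance [sqrt 2] from [0]. *)
Lemma not_fatou_sq_eq1 p : cmod p = 1 -> ~ fatou sq (Some p).
Proof.
move=> p1 [r [r0 normal]]; have [phi [phi_inc [g gP]]] := normal id.
have phi_ge j : (j <= phi j)%N.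
  by elim: j => // j IH; rewrite (leq_ltn_trans IH).
have {gP}[|rho [rho0 [_ unif]]] := gP (Some p); first by rewrite chordalxx.
have [|N NP] := unif (1 / 5); first by lra.
set n := (2 ^ phi N)%N; have n0 : 0 < n%:R :> R by rewrite ltr0n expn_gt0.
(* The bound [rho / 4] keeps [q] in the ball of uniform convergence around [p]; the bound
   [1 / (10 * n%:R)] keeps the [n]-th powers of [p] and [q] within chordal distance 1/5, by
   Bernoulli; the bound [1 / 2] keeps [1 - h] positive. *)
set h := Num.min (1 / 2) (Num.min (rho / 4) (1 / (10 * n%:R))).
have h0 : 0 < h by rewrite !lt_min !divr_gt0 ?mulr_gt0.
have h2 : h <= 1 / 2 by rewrite /h ge_min lexx.
have hrho : h <= rho / 4 by rewrite /h !ge_min lexx orbT.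
have hn : h *+ n <= 1 / 10.
  rewrite -[h *+ n]mulr_natr -ler_pdivlMr // -mulrA -invfM.
  by rewrite /h !ge_min mul1r lexx !orbT.
set q := (1 - h)%:C * p.
have cmodq : cmod q = 1 - h by rewrite cmodM p1 mulr1 cmod_real ger0_norm //; lra.
have pq : chordal (Some p) (Some q) < rho.
  apply: le_lt_trans (chordal_le _ _) _.
  have -> : p - q = h%:C * p by rewrite /q rmorphB rmorph1 /=; ring.
  rewrite cmodM p1 mulr1 cmod_real gtr0_norm //; lra.
have [||N' N'P] := expr_small (1 - h) (1 / 10) _ _; [lra|lra|].
set j := maxn N N'.
have q_to_0 : chordal (Some 0) (iter (phi j) sq (Some q)) < 1 / 5.
  rewrite iter_sq; apply: le_lt_trans (chordal_le _ _) _.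
  rewrite sub0r cmodN cmodX cmodq.
  suff : (1 - h) ^+ (2 ^ phi j) < 1 / 10 by lra.
  apply: N'P; rewrite (leq_trans (leq_maxr N N')) // (leq_trans (phi_ge _)) //.
  by rewrite ltnW // ltn_expl.
have gq_j := NP j (leq_maxl _ _) _ pq.
have gq_N := NP N (leqnn _) _ pq.
have close : chordal (iter (phi N) sq (Some q)) (iter (phi N) sq (Some p)) <= 1 / 5.
  rewrite !iter_sq -/n; apply: le_trans (chordal_le _ _) _.
  have -> : q ^+ n - p ^+ n = ((1 - h) ^+ n - 1)%:C * p ^+ n.
    by rewrite /q exprMn -rmorphXn [in RHS]rmorphB rmorph1 mulrBl mul1r.
  rewrite cmodM cmodX p1 expr1n mulr1 cmod_real.
  have := @bernoulli_le h n; have : (1 - h) ^+ n <= 1 by rewrite exprn_ile1; lra.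
  move=> le1 /(_ _); rewrite ler0_norm; last lra.
  by move=> ge; have := ge ltac:(lra); lra.
have far : 1 <= chordal (Some 0) (iter (phi N) sq (Some p)).
  rewrite iter_sq /= sub0r cmodN cmodX p1 expr1n cmod0 expr0n addr0 sqrtr1 mul1r mulr1.
  rewrite expr1n ler_pdivlMr ?sqrtr_gt0; last lra.
  rewrite mul1r -[leRHS]ger0_norm // -sqrtr_sqr ler_wsqrtr //; lra.
(* Chain: 0, the iterate [phi j] of [q], the limit [g] at [q], the iterate [phi N] of [q], that of
   [p]. Four steps of at most 1/5 cannot span a distance of at least 1. *)
have t1 := chordal_triangle (Some 0) (iter (phi j) sq (Some q)) (iter (phi N) sq (Some p)).
have t2 := chordal_triangle (iter (phi j) sq (Some q)) (g (Some q)) (iter (phi N) sq (Some p)).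
have t3 := chordal_triangle (g (Some q)) (iter (phi N) sq (Some q)) (iter (phi N) sq (Some p)).
move: gq_N; rewrite chordalC => gq_N; lra.
Qed.

Lemma julia_sq_ratio p q : (p, q) != (0, 0) ->
  julia sq (ratio p q) <-> cmod p = cmod q.
Proof.
move=> pq0.
have lt_fatou p' q' : cmod p' < cmod q' -> fatou sq (ratio p' q').
  move=> lt; have q0 : q' != 0 by rewrite -cmod_gt0 (le_lt_trans (cmod_ge0 p')).
  rewrite /ratio (negbTE q0); apply: fatou_sq_lt1.
  by rewrite cmodM cmodV ltr_pdivrMr ?cmod_gt0 // mul1r.
split=> [J|e]; last first.
  have q0 : q != 0.
    apply: contra pq0 => /eqP q0; move: e; rewrite q0 cmod0 => /eqP.
    by rewrite cmod_eq0 => /eqP ->.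
  rewrite /ratio (negbTE q0); apply: not_fatou_sq_eq1.
  by rewrite cmodM cmodV e divff // cmod_eq0.
apply/eqP; rewrite eq_le !leNgt; apply/andP; split; apply/negP=> lt; apply: J;
  last exact: lt_fatou.
(* Remaining case |q| < |p|: the inversion z -> 1/z commutes with squaring and brings the exterior
   of the unit circle to its interior. *)
have det0 : (0 : C) * 0 - 1 * 1 != 0 by rewrite mulr0 mulr1 sub0r oppr_eq0 oner_neq0.
have detV0 : (0 : C) * 0 - (- 1) * (- 1) != 0 by rewrite mulrNN.
have [K K0 lip] := mobius_lipschitz _ _ _ _ det0.
have [L L0 lipV] := mobius_lipschitz _ _ _ _ detV0.
have -> : ratio p q = mobius 0 1 1 0 (ratio q p).
  by rewrite mobius_ratio; [congr ratio; ring|rewrite xpair_eqE andbC -xpair_eqE].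
apply: fatou_conj (mobiusK _ _ _ _ det0) (mobiusVK _ _ _ _ det0) K0 lip L0 lipV
  (lt_fatou _ _ lt) => x.
have [u [v [uv0 ->]]] := ratioP x.
rewrite mobius_ratio // !sq_ratio mobius_ratio; first by congr ratio; ring.
by rewrite xpair_eqE !sqrf_eq0 -xpair_eqE.
Qed.

End FatouSets.

(** * Schröder's map in lowest terms and its conjugacy to squaring *)

Section Schroeder.
Context {R : realType}.
Local Notation C := R[i].
Implicit Types (a b c d z : C) (P Q G : {poly C}).

(** [gcdp] is determined only up to a unit, hence the constant [c], which drops out of quotients. *)
Lemma gcdp_cancel P Q G : G != 0 -> coprimep P Q ->
  exists2 c, c != 0 & (G * P) %/ gcdp (G * P) (G * Q) = c *: P /\
                      (G * Q) %/ gcdp (G * P) (G * Q) = c *: Q.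
Proof.
move=> G0 PQ; have : gcdp (G * P) (G * Q) %= G.
  apply: eqp_trans (gcdp_mul2l _ _ _) _.
  by rewrite -[X in _ %= X]mulr1 eqp_mul2l // gcdp_eqp1.
by move=> /eqpf_eq[c c0 ->]; exists c^-1; rewrite ?invr_eq0 // !divpZr // !mulKp.
Qed.

Lemma ratmap_Some P Q G z : G != 0 -> coprimep P Q ->
  ratmap (G * P) (G * Q) (Some z) = ratio P.[z] Q.[z].
Proof.
move=> G0 PQ; have [c c0 [eP eQ]] := gcdp_cancel P Q G G0 PQ.
by rewrite /ratmap eP eQ !hornerZ -(ratioZ c).
Qed.

(** Taking the coefficient of [P] at the degree of [Q] merges two branches of [ratmap]: it vanishes
    if [P] has smaller degree and is the leading one if the degrees agree. *)
Lemma ratmap_None P Q G : G != 0 -> coprimep P Q -> (size P <= size Q)%N -> Q != 0 ->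
  ratmap (G * P) (G * Q) None = ratio P`_(size Q).-1 (lead_coef Q).
Proof.
move=> G0 PQ leq Q0; have [c c0 [eP eQ]] := gcdp_cancel P Q G G0 PQ.
rewrite /ratmap eP eQ !size_scale // ltnNge leq /= /ratio lead_coef_eq0 (negbTE Q0).
case: ltnP => [lt|ge]; first by rewrite nth_default ?mul0r // -ltnS prednK // size_poly_gt0.
have -> : size Q = size P by apply/eqP; rewrite eqn_leq leq ge.
rewrite !lead_coefZ; congr Some; rewrite /lead_coef; field.
by rewrite c0 -lead_coefE lead_coef_eq0 Q0.
Qed.

(** Numerator and denominator of S_f both take this form once the common factor is cancelled. *)
Definition quad a b c d : {poly C} :=
  c *: ('X - b%:P) ^+ 2 + d *: ('X - a%:P) ^+ 2.

Lemma quadE a b c d :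
  quad a b c d = (c + d) *: 'X^2 - ((c * b + d * a) *+ 2) *: 'X + (c * b ^+ 2 + d * a ^+ 2)%:P.
Proof. by rewrite /quad -!mul_polyC; ring. Qed.

Lemma coef2_quad a b c d : (quad a b c d)`_2 = c + d.
Proof. by rewrite quadE !coefE /=; ring. Qed.

Lemma size_quad_le a b c d : (size (quad a b c d) <= 3)%N.
Proof. by apply/leq_sizeP => -[|[|[|j]]] // _; rewrite quadE !coefE /=; ring. Qed.

Lemma size_quad a b c d : c + d != 0 -> size (quad a b c d) = 3%N.
Proof.
move=> cd0; apply/eqP; rewrite eqn_leq size_quad_le ltnNge; apply/negP => /leq_sizeP/(_ 2%N).
by rewrite coef2_quad => /(_ (leqnn _)) /eqP; rewrite (negbTE cd0).
Qed.

Lemma horner_quad a b c d z : (quad a b c d).[z] = c * (z - b) ^+ 2 + d * (z - a) ^+ 2.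
Proof. by rewrite /quad !hornerE. Qed.

Section FPoly.
Context (a b : C) (m n : nat) (ab : a != b).
(** Successor exponents avoid truncated subtraction in f'. [G] is the factor that cancels, leaving
    S_f = P / Q, and [W] is the cofactor of U^m V^n in f'. *)
Let f := fpoly m.+1 n.+1 a b.
Let U := 'X - a%:P.
Let V := 'X - b%:P.
Let G := (U ^+ m * V ^+ n) ^+ 2.
Let W := V *+ m.+1 + U *+ n.+1.
Let P := quad a b (a * m.+1%:R) (b * n.+1%:R).
Let Q := quad a b m.+1%:R n.+1%:R.

Lemma deriv_fpoly : f^`() = U ^+ m * V ^+ n * W.
Proof.
by rewrite /f /fpoly derivM !deriv_exp !derivXsubC !mul1r /= -/U -/V !exprS /W; ring.
Qed.

(* Differentiating [f' U V = f W] yields [f'' U V] without expanding [f'']; the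
   factor [U V] is cancelled at the end. *)
Lemma schroeder_den_fpoly : schroeder_den f = G * Q.
Proof.
have fE : f = U ^+ m * V ^+ n * (U * V) by rewrite /f /fpoly -/U -/V !exprS; ring.
have UV0 : U * V != 0 by rewrite mulf_neq0 // polyXsubC_eq0.
have : (f^`() * (U * V))^`() = (f * W)^`().
  by congr deriv; rewrite deriv_fpoly fE; ring.
have dU : U^`() = 1 := derivXsubC a; have dV : V^`() = 1 := derivXsubC b.
have dW : W^`() = m.+1%:R + n.+1%:R by rewrite /W derivD !derivMn dU dV.
rewrite (derivM f^`() (U * V)) (derivM f W) (derivM U V) dU dV dW => D2.
apply: (mulIf UV0); rewrite /schroeder_den derivSn derivn1.
have {}D2 : f^`()^`() * (U * V) = f^`() * W + f * (m.+1%:R + n.+1%:R) - f^`() * (V + U).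
  by rewrite -D2; ring.
rewrite mulrBl -[f * _ * _]mulrA D2 deriv_fpoly fE /G /Q /quad -/U -/V /W.
by rewrite -!mul_polyC !rmorph_nat; ring.
Qed.

Lemma schroeder_num_fpoly : schroeder_num f = G * P.
Proof.
rewrite /schroeder_num schroeder_den_fpoly deriv_fpoly /f /fpoly -/U -/V.
rewrite /G /P /Q /W /quad -!mul_polyC !rmorphM !rmorph_nat /= -/U -/V !exprS.
(* Eliminating the constants leaves a polynomial identity in ['X], [U] and [V]. *)
have -> : a%:P = 'X - U by rewrite /U; ring.
have -> : b%:P = 'X - V by rewrite /V; ring.
by ring.
Qed.

(** P - a Q and P - b Q are nonzero multiples of (z - a)^2 and (z - b)^2, so a common root would
    equal both [a] and [b]. *)
Lemma coprime_schroeder : coprimep P Q.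
Proof.
apply/Pdiv.ClosedField.coprimepP => z; rewrite /root !horner_quad => /eqP Pz.
apply/negP => /eqP Qz; move/negP: ab; apply.
have /eqP : n.+1%:R * (b - a) * (z - a) ^+ 2 = 0.
  by rewrite -[RHS](subr0 0) -{1}Pz -(mulr0 a) -Qz; ring.
have /eqP : m.+1%:R * (a - b) * (z - b) ^+ 2 = 0.
  by rewrite -[RHS](subr0 0) -{1}Pz -(mulr0 b) -Qz; ring.
rewrite !(sqrf_eq0, mulf_eq0) !pnatr_eq0 !subr_eq0 [b == a]eq_sym (negbTE ab) /=.
by move=> /eqP -> /eqP ba; move: ab; rewrite ba eqxx.
Qed.

(** The homogeneous form covers infinity too: there u = v = 1, and the value is the quotient of the
    coefficients of degree 2, that of [Q] being the nonzero sum of the exponents. *)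
Lemma schroederE x : let u := (hom x).1 - a * (hom x).2 in
  let v := (hom x).1 - b * (hom x).2 in
  schroeder f x = ratio (a * m.+1%:R * v ^+ 2 + b * n.+1%:R * u ^+ 2)
                        (m.+1%:R * v ^+ 2 + n.+1%:R * u ^+ 2).
Proof.
have G0 : G != 0 by rewrite !(expf_neq0, mulf_neq0) // polyXsubC_eq0.
have mn0 : m.+1%:R + n.+1%:R != 0 :> C by rewrite -natrD pnatr_eq0.
have sQ : size Q = 3%N by rewrite size_quad.
rewrite /schroeder schroeder_num_fpoly schroeder_den_fpoly.
case: x => [z|].
  by rewrite ratmap_Some ?coprime_schroeder // !horner_quad /= !mulr1.
rewrite ratmap_None ?coprime_schroeder //.
- by rewrite /= lead_coefE sQ !coef2_quad !mulr0 !subr0 expr1n !mulr1.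
- by rewrite sQ size_quad_le.
- by rewrite -size_poly_eq0 sQ.
Qed.

Lemma julia_schroeder x :
  julia (schroeder f) x <->
  n.+1%:R * cmod ((hom x).1 - a * (hom x).2) = m.+1%:R * cmod ((hom x).1 - b * (hom x).2).
Proof.
(* The matrix of T; its determinant is b - a times the product of the exponents. *)
set p : C := - n.+1%:R; set q : C := n.+1%:R * a.
set r : C := m.+1%:R; set s : C := - (m.+1%:R * b).
have det0 : p * s - q * r != 0.
  rewrite (_ : _ - _ = m.+1%:R * n.+1%:R * (b - a)); last by rewrite /p /q /r /s; ring.
  by rewrite !mulf_neq0 ?pnatr_eq0 // subr_eq0 eq_sym.
have detV0 : s * p - (- q) * (- r) != 0 by rewrite [X in X - _]mulrC [X in _ - X]mulrNN.
pose M := mobius p q r s; pose N := mobius s (- q) (- r) p.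
have [K K0 lip] := mobius_lipschitz _ _ _ _ det0.
have [L L0 lipV] := mobius_lipschitz _ _ _ _ detV0.
have MK : cancel M N by exact: mobiusK.
have NK : cancel N M by exact: mobiusVK.
have SE y : schroeder f y = N (sq (M y)).
  have p'q'0 := mobius_neq0 p q r s _ det0 (hom_neq0 y).
  rewrite schroederE /N /M {2}/mobius sq_ratio mobius_ratio; last first.
    by rewrite xpair_eqE !sqrf_eq0 -xpair_eqE.
  (* The adjugate applied to the squared coordinates returns those of [schroederE] times this
     factor. *)
  rewrite -(ratioZ (- (m.+1%:R * n.+1%:R))) ?oppr_eq0 ?mulf_neq0 ?pnatr_eq0 //.
  by rewrite /p /q /r /s; congr ratio; ring.
have fatouE : fatou (schroeder f) x <-> fatou sq (M x).
  split; first by apply: (fatou_conj _ _ M N K L x _ MK NK) => // y; rewrite SE NK.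
  rewrite -{2}[x]MK; apply: (fatou_conj _ _ N M L K (M x) _ NK MK) => // y.
  by rewrite SE NK.
rewrite /julia fatouE -/(julia sq (M x)) /M /mobius.
rewrite julia_sq_ratio ?mobius_neq0 ?hom_neq0 //.
have natE k : k%:R = cmod (k%:R : C).
  by rewrite -(rmorph_nat (real_complex R)) cmod_real normr_nat.
rewrite !natE -!cmodM -[cmod (n.+1%:R * _)]cmodN.
have -> : p * (hom x).1 + q * (hom x).2 = - (n.+1%:R * ((hom x).1 - a * (hom x).2)).
  by rewrite /p /q; ring.
have -> : r * (hom x).1 + s * (hom x).2 = m.+1%:R * ((hom x).1 - b * (hom x).2).
  by rewrite /r /s; ring.
by [].
Qed.

End FPoly.
End Schroeder.

(* The circle of Apollonius: with [u = z - a] and [v = z - b], the left-hand side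
   reads [|m^2 v - n^2 u| = m n |u - v|]; square it and expand. *)
Lemma apollonius (F : numClosedFieldType) (a b z : F) (m n : nat) : (n < m)%N ->
  (`|z - (b * (m ^ 2)%:R - a * (n ^ 2)%:R) / (m ^ 2 - n ^ 2)%:R|
     = (m * n)%:R * `|a - b| / (m ^ 2 - n ^ 2)%:R) <->
  n%:R * `|z - a| = m%:R * `|z - b|.
Proof.
move=> nm; have lt2 : (n ^ 2 < m ^ 2)%N by rewrite ltn_exp2r.
have D0 : (m ^ 2 - n ^ 2)%:R != 0 :> F by rewrite pnatr_eq0 -lt0n subn_gt0.
have DE : (m ^ 2 - n ^ 2)%:R = m%:R ^+ 2 - n%:R ^+ 2 :> F.
  by rewrite natrB ?natrX // ltnW.
set u := z - a; set v := z - b.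
rewrite (_ : z - _ = (m%:R ^+ 2 * v - n%:R ^+ 2 * u) / (m ^ 2 - n ^ 2)%:R); last first.
  by rewrite /u /v !natrX DE in D0 *; field.
rewrite (_ : a - b = v - u); last by rewrite /u /v; ring.
rewrite normrM normfV normr_nat natrM; clearbody u v.
have sqE : `|m%:R ^+ 2 * v - n%:R ^+ 2 * u| ^+ 2 - (m%:R * n%:R * `|v - u|) ^+ 2 =
   (m ^ 2 - n ^ 2)%:R * ((m%:R * `|v|) ^+ 2 - (n%:R * `|u|) ^+ 2).
  rewrite !exprMn !normCK DE !rmorphB !rmorphM ?rmorphXn !rmorph_nat /=; ring.
have sq_eq (x y : F) : 0 <= x -> 0 <= y -> (x = y <-> x ^+ 2 - y ^+ 2 = 0).
  move=> x0 y0; split=> [->|/eqP]; first by rewrite subrr.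
  by rewrite subr_eq0 eqrXn2 // => /eqP.
split=> [/(divIf D0)|] h.
  apply/esym/sq_eq; rewrite ?mulr_ge0 //; apply: (mulfI D0).
  by rewrite mulr0 -sqE h subrr.
congr (_ / _); apply/sq_eq; rewrite ?mulr_ge0 //.
by rewrite sqE h subrr mulr0.
Qed.

Theorem theorem2 (R : realType) (a b : R[i]) (m n : nat) :
  a != b -> (1 <= n)%N -> (n <= m)%N ->
  (* (1) m = n: the Julia set (in C) is the perpendicular bisector of [a,b] *)
  (m = n ->
     forall z : R[i],
       julia (schroeder (fpoly m n a b)) (Some z) <-> `|z - a| = `|z - b|) /\
  (* (2) m > n: the Julia set is the stated circle (in particular infinity is not in it) *)
  ((n < m)%N ->
     (forall z : R[i],
        julia (schroeder (fpoly m n a b)) (Some z) <->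
        `|z - (b * (m ^ 2)%:R - a * (n ^ 2)%:R) / (m ^ 2 - n ^ 2)%:R|
          = (m * n)%:R * `|a - b| / (m ^ 2 - n ^ 2)%:R) /\
     ~ julia (schroeder (fpoly m n a b)) None).
Proof.
case: n => // n; case: m => // m ab _ le_nm.
have juliaE z : julia (schroeder (fpoly m.+1 n.+1 a b)) (Some z) <->
    n.+1%:R * `|z - a| = m.+1%:R * `|z - b|.
  rewrite julia_schroeder //= !mulr1 !norm_cmod -!(rmorph_nat (real_complex R)).
  rewrite -!(rmorphM (real_complex R)) /=.
  by split=> [->|/complexI].
split=> [[mn] z|lt_nm].
  rewrite juliaE mn; by split=> [|-> //]; apply: mulfI; rewrite pnatr_eq0.
split=> [z|]; first by rewrite juliaE apollonius.
(* At infinity both moduli are 1, so the criterion would force equal exponents. *)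
rewrite julia_schroeder //= !mulr0 !subr0 cmod1 !mulr1 => /eqP.
by rewrite eqr_nat (ltn_eqF lt_nm).
Qed.
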